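(* Let $u\in\mathcal{D}$ and let $V_M$ be the corresponding boundary for $u$ (i.e. $M\ge 0$ is such that $u\in\mathcal{D}_M$). Then for each $p\in V_M$, the limit $\lim_{m\to\infty}H_mu(p)$ exists (in $\mathbb{R}$).
   Context: Fix an integer $N\ge 2$, $S=\{1,\dots,N\}$, and let $\Sigma_N^+=\{x=(x_1x_2\cdots):x_i\in S\}$ with the product topology. Cylinder sets: $[p_1\cdots p_m]=\{x: x_1=p_1,\dots,x_m=p_m\}$. $\mu$ is the Borel probability measure with $\mu([p_1\cdots p_m])=N^{-m}$. $\mathcal{C}(\Sigma_N^+)$ is the set of real continuous functions. For $m\ge 0$, $V_m$ is the set of sequences $p=(p_1\cdots p_m\,p_{m+1}\,p_{m+1}\cdots)$ that are constant from position $m+1$ on; $V_0\subset V_1\subset\cdots$, and $V_{-1}=\emptyset$. For $p\in V_m$, $\mathcal{U}_{p,m}=\{q\in V_m: q\ne p,\ q_i=p_i \text{ for } 1\le i\le m\}$ (a set of $N-1$ points; for $m=0$ it is $V_0\setminus\{p\}$). For $p\in\bigcup_m V_m$, $\kappa_p=\min\{j:p\in V_j\}$. For a real function $u$ defined (at least) on $V_m$ and $p\in V_m$, the difference operator is $$H_m u(p)=\sum_{j=\kappa_p}^{m}\ \sum_{q\in\mathcal{U}_{p,j}}(u(q)-u(p)).$$ Laplacian: for $u,f\in\mathcal{C}(\Sigma_N^+)$, $\Delta u=f$ means $\lim_{m\to\infty}\max_{p\in V_m\setminus V_{m-1}}\left|\frac{H_mu(p)}{\mu([p_1\cdots p_{m+1}])}-f(p)\right|=0$.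 $D_\mu$ is the set of $u\in\mathcal{C}(\Sigma_N^+)$ for which such an $f$ exists. For $M\ge0$, $\mathcal{D}_M$ is the set of $u\in D_\mu$ for which there is $f\in\mathcal{C}(\Sigma_N^+)$ with $\Delta u=f$ and $\lim_{m\to\infty}\max_{p\in V_m\setminus V_M}\left|\frac{H_mu(p)}{\mu([p_1\cdots p_{m+1}])}-f(p)\right|=0$. $\mathcal{D}=\bigcup_{M\ge0}\mathcal{D}_M$. When $u\in\mathcal{D}_M$, the set $V_M$ is taken as the boundary of $\Sigma_N^+$ corresponding to $u$. *)

(* Defs.v *)
From HB Require Import structures.
From mathcomp Require Import all_boot all_order all_algebra.
From mathcomp Require Import all_classical all_reals all_analysis.

Set Implicit Arguments.
Unset Strict Implicit.
Unset Printing Implicit Defensive.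

Import Order.TTheory GRing.Theory Num.Theory.
Import numFieldNormedType.Exports.

Local Open Scope classical_set_scope.
Local Open Scope ring_scope.

(* The alphabet S is 'I_N, with letters numbered from 0: for N > 0, N.-1.+1 is N,
   and the successor form makes the type canonically inhabited. *)
Definition letter (N : nat) : Type := discrete_topology 'I_N.-1.+1.

HB.instance Definition _ (N : nat) := Finite.copy (letter N) 'I_N.-1.+1.
HB.instance Definition _ (N : nat) :=
  DiscreteUniform.copy (letter N) (discrete_topology 'I_N.-1.+1).
HB.instance Definition _ (N : nat) := isPointed.Build (letter N) ord0.

(* Positions are numbered from 0 as well: the k-th letter of p is p (k - 1). *)
Definition shift_space (N : nat) : Type := prod_topology (fun _ : nat => letter N).

HB.instance Definition _ (N : nat) := Pointed.on (shift_space N).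
HB.instance Definition _ (N : nat) := Uniform.on (shift_space N).

Definition borel_shift_space (N : nat) : Type :=
  g_sigma_algebraType (@open (shift_space N)).

HB.instance Definition _ (N : nat) := Measurable.on (borel_shift_space N).

Section Definitions.
Context {R : realType} {N : nat}.
Implicit Types (p q : shift_space N) (u f : shift_space N -> R) (m M : nat).

Definition cylinder p m : set (shift_space N) :=
  [set x | forall i, (i < m)%N -> x i = p i].

Definition V m : set (shift_space N) :=
  [set p | forall i, (m <= i)%N -> p i = p m].

(* V_(m-1), with V_(-1) empty *)
Definition Vpred m : set (shift_space N) := if m is k.+1 then V k else set0.

Definition U p m : set (shift_space N) :=
  [set q | [/\ V m q, q <> p & forall i, (i < m)%N -> q i = p i]].

(* the least j with V j p; the default 0 is taken only when p lies in no V j *)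
Definition kappa p : nat :=
  xget 0%N [set k | V k p /\ forall j, V j p -> (k <= j)%N].

(* U p j is finite (N - 1 points when V j p), so the inner sum is a genuine finite sum. *)
Definition H m u p : R :=
  \sum_(kappa p <= j < m.+1) \sum_(q \in U p j) (u q - u p).

Variable mu : probability (borel_shift_space N) R.

Definition laplacian_error u f m p : R :=
  `| H m u p / fine (mu (cylinder p m.+1)) - f p |.

(* The suprema range over subsets of the finite set V m, so they are maxima when
   the set is nonempty. V m `\` V M is empty exactly for m <= M (if N >= 2); these
   finitely many m, where sup set0 = 0, do not affect the limit. *)
Definition is_laplacian u f : Prop :=
  (fun m => sup [set laplacian_error u f m p | p in V m `\` Vpred m]) @ \oo
    --> (0 : R).

Definition Dmu : set (shift_space N -> R) :=
  [set u | continuous u /\ exists f, continuous f /\ is_laplacian u f].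

Definition D_ M : set (shift_space N -> R) :=
  [set u | Dmu u /\ exists f, [/\ continuous f, is_laplacian u f &
    (fun m => sup [set laplacian_error u f m p | p in V m `\` V M]) @ \oo
      --> (0 : R)]].

Definition D : set (shift_space N -> R) := \bigcup_M D_ M.

End Definitions.

(* Main.v *)
Require Import Defs.
From HB Require Import structures.
From mathcomp Require Import all_boot all_order all_algebra.
From mathcomp Require Import all_classical all_reals all_analysis.

Import Order.TTheory GRing.Theory Num.Theory.
Import numFieldNormedType.Exports.

Local Open Scope classical_set_scope.
Local Open Scope ring_scope.

(** For [p] in [V M] and [m >= kappa p], [H m u p] is a partial sum of the series
    with terms [d j = \sum_(q \in U p j) (u q - u p)], so it suffices to bound
    [d j] geometrically for [j > M].

    Put [j = k + 1] with [k >= M].  The points of [U p j] together with [p] are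
    the [N] points of [V j] that share the first [j] letters of [p].  Each
    [q] in [U p j] lies in [V j] but not in [V k], so [kappa q = j] and
    [H j u q] is the single sum of the differences between [u q] and the values
    of [u] at these [N] points.  Summing these differences over all ordered
    pairs of the [N] points gives zero by antisymmetry, which means
    [d j = - \sum_(q \in U p j) H j u q] (lemma [sum_U_H]).

    Now [u] has a Laplacian [f], which is continuous, hence bounded by
    compactness; the errors form a convergent, hence bounded, sequence.  As
    the cylinder around [q] has measure [N ^- (j + 1)], the value
    [H j u q] is [O (N ^- (j + 1))] uniformly in [q] (lemma [H_decay]), and
    [d j] inherits this bound. *)

Set Implicit Arguments.
Unset Strict Implicit.

Lemma pairwise_difference_sum0 (R : zmodType) (I : finType) (w : I -> R) :
  \sum_a \sum_b (w b - w a) = 0.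
Proof.
under eq_bigr do rewrite sumrB.
by rewrite sumrB (exchange_big_dep predT) //= subrr.
Qed.

(** The vanishing total of all pairwise differences, solved for the
    contribution of one distinguished index. *)
Lemma difference_sum_opp (R : zmodType) (I : finType) (w : I -> R) (c : I) :
  \sum_b (w b - w c) = - \sum_(a | a != c) \sum_b (w b - w a).
Proof.
apply/eqP; rewrite -addr_eq0; apply/eqP.
by rewrite -[RHS](pairwise_difference_sum0 w) [RHS](bigD1 c).
Qed.

Section Space.
Context {R : realType} {N : nat}.
Implicit Types (p q : shift_space N) (u f : shift_space N -> R) (m k : nat).

(** The sequence that agrees with [p] on the first [m] letters and is constantly
    [a] afterwards.  For fixed [p] and [m], letting [a] vary enumerates the
    points of [V m] in the cylinder of [p] of length [m]. *)
Definition splice p m (a : letter N) : shift_space N :=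
  fun i => if (i < m)%N then p i else a.

Lemma V_splice p m a : V m (splice p m a).
Proof. by move=> i mi; rewrite /splice ltnn ltnNge mi. Qed.

Lemma splice_id p m : V m p -> splice p m (p m) = p.
Proof.
by move=> Vp; apply/funext => i; rewrite /splice; case: ltnP => // /Vp ->.
Qed.

Lemma splice_splice p m a b : splice (splice p m a) m b = splice p m b.
Proof. by apply/funext => i; rewrite /splice; case: ifP => // ->. Qed.

Lemma V_le m k p : (m <= k)%N -> V m p -> V k p.
Proof. by move=> mk Vp i ki; rewrite !Vp // (leq_trans mk). Qed.

Lemma splice_notV p k a : V k p -> a != p k -> ~ V k (splice p k.+1 a).
Proof.
move=> Vp /eqP ane /(_ k.+1 (leqnSn k)).
by rewrite /splice ltnn leqnn.
Qed.

Lemma finite_V m : finite_set (@V N m).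
Proof.
(* A point of V m is determined by its first m + 1 letters. *)
pose g (t : {ffun 'I_m.+1 -> letter N}) : shift_space N :=
  fun i => t (inord (minn i m)).
apply: (@sub_finite_set _ _ (range g)); last first.
  exact/finite_image/finite_finset.
move=> p Vp; exists [ffun i : 'I_m.+1 => p i] => //.
apply/funext => i; rewrite /g ffunE inordK ?ltnS ?geq_minr //.
by case: (leqP i m) => // /ltnW /Vp ->.
Qed.

Lemma kappa_splice p k a :
  V k p -> a != p k -> kappa (splice p k.+1 a) = k.+1.
Proof.
move=> Vp ane; apply: xget_unique.
  split; first exact: V_splice.
  move=> j Vj; rewrite ltnNge; apply/negP => jk.
  exact: (splice_notV Vp ane (V_le jk Vj)).
move=> j [Vj jmin]; apply/eqP; rewrite eqn_leq jmin ?andTb; last exact: V_splice.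
rewrite ltnNge; apply/negP => jk.
exact: (splice_notV Vp ane (V_le jk Vj)).
Qed.

(** The sum may run over all letters because [a = p m] gives back [p] itself,
    which contributes zero. *)
Lemma sum_U u p m : V m p ->
  \sum_(q \in U p m) (u q - u p) = \sum_a (u (splice p m a) - u p).
Proof.
move=> Vp.
have bij : set_bij [set a | a != p m] (U p m) (splice p m).
  split.
  - move=> a /= /eqP ane; split; first exact: V_splice.
      move=> /(congr1 (fun q => q m)); rewrite /splice ltnn; exact: ane.
    by move=> i im; rewrite /splice im.
  - move=> a b _ _ /(congr1 (fun q => q m)); by rewrite /splice ltnn.
  - move=> q [Vq qp agree]; exists (q m).
      apply/eqP => qpm; apply: qp.
      rewrite -(splice_id Vp) -(splice_id Vq) qpm.
      by apply/funext => i; rewrite /splice; case: ifP => // /agree.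
    rewrite -[RHS](splice_id Vq).
    by apply/funext => i; rewrite /splice; case: ifP => // /agree.
rewrite (reindex_fsbig _ _ _ _ bij).
rewrite (fsbig_fwiden (index_enum (letter N))) //.
- by move=> a _; rewrite /= mem_index_enum.
- exact: index_enum_uniq.
- move=> a [_ /= /negP]; rewrite negbK => /eqP ->.
  by rewrite splice_id // subrr.
Qed.

Lemma H_splice u p k a : V k p -> a != p k ->
  H k.+1 u (splice p k.+1 a) =
  \sum_b (u (splice p k.+1 b) - u (splice p k.+1 a)).
Proof.
move=> Vp ane; rewrite /H kappa_splice // big_nat1 sum_U; last exact: V_splice.
by apply: eq_bigr => b _; rewrite splice_splice.
Qed.

(** The increment of [H] at an old point [p] is, up to sign, the total of [H]
    over the new points of level [k.+1] surrounding it. *)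
Lemma sum_U_H u p k : V k p ->
  \sum_(q \in U p k.+1) (u q - u p) =
  - \sum_(a | a != p k) H k.+1 u (splice p k.+1 a).
Proof.
move=> Vp; have VSp := V_le (leqnSn k) Vp.
rewrite sum_U //.
have pE : p = splice p k.+1 (p k).
  by rewrite -(Vp k.+1 (leqnSn k)) splice_id.
rewrite {2}pE (difference_sum_opp (fun a => u (splice p k.+1 a))).
by congr (- _); apply: eq_bigr => a ane; rewrite H_splice.
Qed.

Lemma compact_shift_space : compact [set: shift_space N].
Proof.
have cptT (i : nat) : compact [set: letter N].
  exact/finite_compact/finite_finset.
by have := tychonoff cptT; congr (compact _); apply/seteqP; split.
Qed.

Lemma continuous_bounded f : continuous f -> exists B : R, forall q, `|f q| <= B.
Proof.
move=> cf.
have /compact_bounded [B [_ hB]] :=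
  continuous_compact (continuous_subspaceT cf) compact_shift_space.
by exists (B + 1) => q; apply: hB; rewrite ?ltrDl //; exists q.
Qed.

(** Since [V m] is finite, the supremum is an upper bound of the errors. *)
Lemma laplacian_error_le_sup (mu : probability (borel_shift_space N) R)
    u f m (A : set (shift_space N)) q : A q -> V m q ->
  laplacian_error mu u f m q <=
  sup [set laplacian_error mu u f m p | p in V m `&` A].
Proof.
move=> Aq Vq; apply: sup_upper_bound; last by exists q.
split; first by exists (laplacian_error mu u f m q); exists q.
have : finite_set [set laplacian_error mu u f m p | p in V m `&` A].
  by apply: finite_image; apply: sub_finite_set (finite_V m) => ? [].
move/finite_compact/compact_bounded => [B [_ hB]].
exists (B + 1) => x Ax; apply: le_trans (ler_norm x) _.
by apply: hB; rewrite ?ltrDl.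
Qed.

(** At the points that are new at level [m], [H m u] has the order of magnitude of
    the measure of a cylinder of length [m.+1], uniformly in the point. *)
Lemma H_decay (hN : (2 <= N)%N) (mu : probability (borel_shift_space N) R)
    (hmu : forall p m, mu (cylinder p m) = (N%:R ^- m)%:E) u f :
  continuous f -> is_laplacian mu u f ->
  exists C : R, forall m q, V m q -> ~ Vpred m q ->
    `|H m u q| <= C * N%:R^-1 ^+ m.+1.
Proof.
move=> /continuous_bounded[B fB] lap.
have [E [_ hE]] : bounded_fun
    (fun m => sup [set laplacian_error mu u f m p | p in V m `\` Vpred m]).
  by apply: cvg_seq_bounded; apply/cvg_ex; exists 0.
exists (E + 1 + B) => m q Vq nVq.
have N0 : (0 < N%:R :> R) by rewrite ltr0n (leq_trans _ hN).
have errE : laplacian_error mu u f m q <= E + 1.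
  apply: le_trans (laplacian_error_le_sup (A := ~` Vpred m) mu u f nVq Vq) _.
  by apply: le_trans (ler_norm _) _; apply: hE; rewrite ?ltrDl.
rewrite exprVn -ler_pdivrMr ?invr_gt0 ?exprn_gt0 //.
have -> : `|H m u q| / N%:R ^- m.+1 = `|H m u q / fine (mu (cylinder q m.+1))|.
  by rewrite hmu /= normrM [X in _ = _ * X]ger0_norm // invrK exprn_ge0 // ltW.
rewrite -[X in `|X|](subrK (f q)).
by apply: le_trans (ler_normD _ _) _; apply: lerD.
Qed.

Lemma cvg_series_eventually_geometric (d : nat -> R) (M : nat) (C z : R) :
  `|z| < 1 -> (forall j, (M <= j)%N -> `|d j| <= C * z ^+ j) -> cvgn (series d).
Proof.
move=> z1 dle; rewrite -(is_cvg_series_restrict M).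
(* Only the terms from M on are controlled, so the others are set to zero. *)
pose d' j := if (M <= j)%N then d j else 0.
have -> : (fun n => \sum_(M <= j < n) d j) = (fun n => \sum_(M <= j < n) d' j).
  by apply/funext => n; apply: eq_big_nat => j /andP[Mj _]; rewrite /d' Mj.
rewrite (is_cvg_series_restrict M); apply: normed_cvg.
apply: (@series_le_cvg _ _ (fun j => `|C| * `|z| ^+ j)).
- by move=> j; exact: normr_ge0.
- by move=> j; rewrite mulr_ge0 // exprn_ge0.
- move=> j; rewrite /d' /=; case: ifP => [Mj|_]; last first.
    by rewrite normr0 mulr_ge0 // exprn_ge0.
  by rewrite -normrX -normrM (le_trans (dle _ Mj)) // ler_norm.
- by apply: is_cvg_geometric_series; rewrite normr_id.
Qed.

End Space.

Unset Implicit Arguments.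
Set Strict Implicit.

Theorem lemma5p1 (R : realType) (N : nat) (hN : (2 <= N)%N)
    (mu : probability (borel_shift_space N) R)
    (hmu : forall (p : shift_space N) (m : nat),
        mu (cylinder p m) = (N%:R ^- m)%:E)
    (u : shift_space N -> R) (hu : D mu u)
    (M : nat) (hM : D_ mu M u)
    (p : shift_space N) (hp : V M p) :
  exists l : R, (fun m : nat => H m u p) @ \oo --> l.
Proof.
have [_ [f [cf lap _]]] := hM.
have [C HC] := H_decay hN hmu cf lap.
pose d j : R := \sum_(q \in U p j) (u q - u p).
have dle j : (M.+1 <= j)%N ->
    `|d j| <= (\sum_(a : letter N) `|C / N%:R|) * N%:R^-1 ^+ j.
  case: j => // k Mk; have Vp := V_le (Mk : (M <= k)%N) hp.
  rewrite /d sum_U_H // normrN mulr_suml.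
  apply: le_trans (ler_norm_sum _ _ _) _.
  rewrite [leRHS](bigID (fun a => a != p k)) /=.
  apply: ler_wpDr.
    by apply: sumr_ge0 => a _; rewrite mulr_ge0 // exprn_ge0 // invr_ge0.
  apply: ler_sum => a ane.
  apply: le_trans (HC k.+1 _ (@V_splice _ p k.+1 a) (splice_notV Vp ane)) _.
  by rewrite exprS mulrA ler_wpM2r ?exprn_ge0 ?invr_ge0 // ler_norm.
have invN1 : `|N%:R^-1 : R| < 1.
  by rewrite ger0_norm ?invr_ge0 // invf_lt1 ?ltr1n ?ltr0n // (leq_trans _ hN).
have := cvg_series_eventually_geometric invN1 dle.
rewrite -(is_cvg_series_restrict (kappa p)) => /cvg_ex[l dl].
(* H m u p is the sum of d j over kappa p <= j < m.+1, hence the shift. *)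
by exists l; move: dl; rewrite -cvg_shiftS.
Qed.
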